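(* Let $A,B:\mathbb{R}^n\rightrightarrows\mathbb{R}^n$ be piecewise polyhedral mappings such that $\operatorname{zer}T_{\mathrm{PD}}$ is nonempty, closed and convex. Suppose there exist $\beta_{\rm P},\beta_{\rm D}\in\mathbb{R}$ with $[\beta_{\rm D}]_-[\beta_{\rm P}]_-<\tfrac14$ such that $T_{\mathrm{PD}}$ has $V$-oblique weak Minty solutions at $\mathcal{S}^\star=\operatorname{zer}T_{\mathrm{PD}}$, where $V:=\operatorname{blkdiag}(\beta_{\rm P}\mathrm{I}_n,\beta_{\rm D}\mathrm{I}_n)$. Let $$\gamma\in\left(\frac{2[-\beta_{\rm P}]_+}{1+\sqrt{1-4\beta_{\rm D}\beta_{\rm P}}},\ \frac{1+\sqrt{1-4\beta_{\rm D}\beta_{\rm P}}}{2[-\beta_{\rm D}]_+}\right)$$ and suppose that the resolvents $J_{\gamma A}$ and $J_{\gamma B}$ have full domain and are continuous. Consider a sequence $(u^k,v^k,s^k)_{k\in\mathbb{N}}$ generated by Douglas–Rachford splitting (DRS) starting from $s^0\in\mathbb{R}^n$ with stepsize $\gamma$ and relaxation parameters $\lambda_k\in(0,2\alpha)$ such that $\liminf_{k\to\infty}\lambda_k(2\alpha-\lambda_k)>0$, where $\alpha:=1+\tfrac1\gamma\beta_{\rm P}+\gamma\beta_{\rm D}$. Then $(s^k)_{k\in\mathbb{N}}$ converges $R$-linearly to some element of $\{x^\star-\gamma y^\star\mid(x^\star,y^\star)\in\operatorname{zer}T_{\mathrm{PD}}\}$ and $(\|u^k-v^k\|)_{k\in\mathbb{N}}$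 converges $R$-linearly to zero.
   Context: A set-valued mapping is piecewise polyhedral if its graph is the union of finitely many polyhedral sets. For a set-valued operator $T$: $\operatorname{gph}T=\{(x,y):y\in Tx\}$, $\operatorname{zer}T=\{x:0\in Tx\}$. Resolvent: $J_A=(\mathrm{id}+A)^{-1}$. $[t]_+=\max\{0,t\}$, $[t]_-=\min\{0,t\}$; the right endpoint of the stepsize interval is read as $+\infty$ when $[-\beta_{\rm D}]_+=0$ and the left endpoint as $0$ when $[-\beta_{\rm P}]_+=0$. (DRS): $u^k\in J_{\gamma A}(s^k)$, $v^k\in J_{\gamma B}(2u^k-s^k)$, $s^{k+1}=s^k+\lambda_k(v^k-u^k)$. Primal-dual operator on $\mathbb{R}^{2n}$: $T_{\mathrm{PD}}(x,y)=\big(Ax+y\big)\times\big(B^{-1}y-x\big)$. $T$ has $V$-oblique weak Minty solutions at a nonempty set $\mathcal{S}^\star\subseteq\operatorname{zer}T$ if $\langle v,z-z^\star\rangle\ge\langle v,Vv\rangle$ for all $z^\star\in\mathcal{S}^\star$ and $(z,v)\in\operatorname{gph}T$. $(z^k)$ converges to $z^\star$ $Q$-linearly if there are $c\in(0,1)$ and $k_0$ with $\|z^{k+1}-z^\star\|\le c\|z^k-z^\star\|$ for all $k\ge k_0$; it converges $R$-linearly if $\|z^k-z^\star\|\le v^k$ for some nonnegative scalars $(v^k)$ converging $Q$-linearly to zero. *)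

(* Defs.v *)
From mathcomp Require Import all_boot all_order all_algebra.
From mathcomp Require Import all_classical all_reals all_analysis.

Set Implicit Arguments.
Unset Strict Implicit.
Unset Printing Implicit Defensive.

Import Order.TTheory GRing.Theory Num.Theory.
Import numFieldNormedType.Exports.

Local Open Scope classical_set_scope.
Local Open Scope ring_scope.

(* The library norm on matrices is the sup norm; Q-linear convergence depends
   on the norm, hence the explicit Euclidean norm below. *)
Definition dot (R : realType) (n : nat) (x y : 'cV[R]_n) : R :=
  (x^T *m y) 0 0.

Definition enorm (R : realType) (n : nat) (x : 'cV[R]_n) : R :=
  Num.sqrt (dot x x).

Definition pospart (R : realType) (t : R) : R := Num.max 0 t.

(* The negative part is nonpositive. *)
Definition negpart (R : realType) (t : R) : R := Num.min 0 t.

Definition gph (R : realType) (p q : nat) (T : 'cV[R]_p -> set 'cV[R]_q) :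
    set 'cV[R]_(p + q) :=
  [set z | T (usubmx z) (dsubmx z)].

Definition zer (R : realType) (p q : nat) (T : 'cV[R]_p -> set 'cV[R]_q) :
    set 'cV[R]_p :=
  [set x | T x 0].

Definition op_inv (R : realType) (p q : nat) (T : 'cV[R]_p -> set 'cV[R]_q) :
    'cV[R]_q -> set 'cV[R]_p :=
  fun y => [set x | T x y].

Definition op_scale (R : realType) (p q : nat) (gamma : R)
    (T : 'cV[R]_p -> set 'cV[R]_q) : 'cV[R]_p -> set 'cV[R]_q :=
  fun x => [set gamma *: a | a in T x].

Definition id_add (R : realType) (n : nat) (A : 'cV[R]_n -> set 'cV[R]_n) :
    'cV[R]_n -> set 'cV[R]_n :=
  fun x => [set x + a | a in A x].

Definition resolvent (R : realType) (n : nat) (A : 'cV[R]_n -> set 'cV[R]_n) :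
    'cV[R]_n -> set 'cV[R]_n :=
  op_inv (id_add A).

Definition full_domain (R : realType) (p q : nat)
    (T : 'cV[R]_p -> set 'cV[R]_q) : Prop :=
  forall x, T x !=set0.

(* Continuity of a set-valued mapping in the Painleve-Kuratowski sense
   (Rockafellar and Wets, Variational Analysis, Definition 5.4); for a
   single-valued mapping with full domain it agrees with ordinary
   continuity. *)
Definition outer_limit (R : realType) (p q : nat)
    (T : 'cV[R]_p -> set 'cV[R]_q) (x : 'cV[R]_p) : set 'cV[R]_q :=
  [set y | exists (xs : nat -> 'cV[R]_p) (ys : nat -> 'cV[R]_q),
    [/\ xs @ \oo --> x, ys @ \oo --> y & forall k, T (xs k) (ys k)]].

Definition inner_limit (R : realType) (p q : nat)
    (T : 'cV[R]_p -> set 'cV[R]_q) (x : 'cV[R]_p) : set 'cV[R]_q :=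
  [set y | forall xs : nat -> 'cV[R]_p, xs @ \oo --> x ->
    exists2 ys : nat -> 'cV[R]_q,
      ys @ \oo --> y & \forall k \near \oo, T (xs k) (ys k)].

Definition sv_continuous (R : realType) (p q : nat)
    (T : 'cV[R]_p -> set 'cV[R]_q) : Prop :=
  forall x, outer_limit T x `<=` T x /\ T x `<=` inner_limit T x.

Definition polyhedral (R : realType) (N : nat) (P : set 'cV[R]_N) : Prop :=
  exists (m : nat) (M : 'M[R]_(m, N)) (b : 'cV[R]_m),
    P = [set z | forall i, (M *m z) i 0 <= b i 0].

Definition piecewise_polyhedral (R : realType) (p q : nat)
    (T : 'cV[R]_p -> set 'cV[R]_q) : Prop :=
  exists (r : nat) (P : 'I_r -> set 'cV[R]_(p + q)),
    (forall i, polyhedral (P i)) /\ gph T = \bigcup_i P i.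

Definition T_PD (R : realType) (n : nat) (A B : 'cV[R]_n -> set 'cV[R]_n) :
    'cV[R]_(n + n) -> set 'cV[R]_(n + n) :=
  fun z => let x := usubmx z in let y := dsubmx z in
    [set col_mx (a + y) (b - x) | a in A x & b in op_inv B y].

Definition oblique_weak_minty (R : realType) (N : nat) (V : 'M[R]_N)
    (T : 'cV[R]_N -> set 'cV[R]_N) (S : set 'cV[R]_N) : Prop :=
  [/\ S !=set0, S `<=` zer T &
    forall zs z v, S zs -> gph T (col_mx z v) ->
      dot v (z - zs) >= dot v (V *m v)].

Definition blkdiagV (R : realType) (n : nat) (bP bD : R) : 'M[R]_(n + n) :=
  block_mx bP%:M 0 0 bD%:M.

(* Splitting off the degenerate endpoints matters: when both parameters are
   positive, 1 - 4 * bD * bP may be negative, and the square root is then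
   not used. *)
Definition stepsize_lb (R : realType) (bP bD : R) : R :=
  if pospart (- bP) == 0 then 0
  else 2 * pospart (- bP) / (1 + Num.sqrt (1 - 4 * bD * bP)).

Definition stepsize_ub (R : realType) (bP bD : R) : \bar R :=
  if pospart (- bD) == 0 then +oo%E
  else ((1 + Num.sqrt (1 - 4 * bD * bP)) / (2 * pospart (- bD)))%:E.

Definition is_DRS (R : realType) (n : nat) (A B : 'cV[R]_n -> set 'cV[R]_n)
    (gamma : R) (lambda : nat -> R) (u v s : nat -> 'cV[R]_n) : Prop :=
  forall k, [/\ resolvent (op_scale gamma A) (s k) (u k),
    resolvent (op_scale gamma B) (2 *: u k - s k) (v k) &
    s k.+1 = s k + lambda k *: (v k - u k)].

Definition Q_linear (R : realType) (E : zmodType) (N : E -> R)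
    (z : nat -> E) (zs : E) : Prop :=
  exists (c : R) (k0 : nat), 0 < c < 1 /\
    forall k, (k0 <= k)%N -> N (z k.+1 - zs) <= c * N (z k - zs).

Definition R_linear (R : realType) (E : zmodType) (N : E -> R)
    (z : nat -> E) (zs : E) : Prop :=
  exists w : nat -> R, [/\ forall k, 0 <= w k,
    Q_linear (fun t : R => `|t|) w 0 & forall k, N (z k - zs) <= w k].

(* Main.v *)
Require Import Defs.
From mathcomp Require Import all_boot all_order all_algebra.
From mathcomp Require Import all_classical all_reals all_analysis.
From mathcomp Require Import ring lra.
Import Order.TTheory GRing.Theory Num.Theory.
Import numFieldNormedType.Exports.
Local Open Scope classical_set_scope.
Local Open Scope ring_scope.
Set Implicit Arguments.
Unset Strict Implicit.
Unset Printing Implicit Defensive.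

(** Write S for the set of points x - gamma y with (x, y) a zero of the
    primal-dual operator; the proof shows that the governing sequence s
    approaches S fast enough to converge.

    One DRS step picks a in A u and b in B v with s = u + gamma a and
    u - v = gamma (a + b), so that (a + b, v - u) is a value of the primal-dual
    operator at (u, b).  The weak Minty inequality at this pair then reads
    alpha |u - v|^2 <= <u - v, s - p> for every p in S
    ([weak_minty_residual]), and expanding the square of the update gives the
    Fejer inequality |s+ - p|^2 <= |s - p|^2 - lambda (2 alpha - lambda)
    |u - v|^2, where the coefficient of |u - v|^2 is eventually bounded below.

    Conversely, a small residual forces s to be close to S.  The tuples
    (u, a, v, b) with a in A u and b in B v form a finite union of polyhedra,
    and S is the linear image of the part of it on which the linear map
    (u - v, a + b) vanishes.  On a polyhedron, Hoffman's bound gives a zero of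
    such a map at distance O(residual), unless there is no zero, in which case
    the residual is bounded away from 0; either way small residuals are
    controlled ([piecewise_polyhedral_error_bound]).  Both alternatives come at
    once out of Fourier-Motzkin elimination
    ([inequality_system_error_bound]).

    Combining the two, the squared distance from s to S decreases by at least
    c |u - v|^2, which is a fixed fraction of it once the residual is small:
    it decays geometrically, and so do the residual and, by the Fejer property,
    the diameter of the tails of s ([fejer_error_bound_geometric],
    [geometric_fejer_limit]).  The limit lies in S because the same polyhedral
    estimate shows S to be closed ([DRS_limits_closed]). *)

(** * Error bound for a system of linear inequalities *)

(** The maximum of [t - delta] and of the lower bounds is a solution: each of
    the two compatibility hypotheses puts one kind of term below the upper
    bounds. *)
Lemma interval_point (R : realFieldType) (I : finType) (lo hi : pred I)
    (f : I -> R) (t delta : R) :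
  0 <= delta ->
  (forall i j, lo i -> hi j -> f i <= f j) ->
  (forall i, lo i -> f i <= t + delta) ->
  (forall j, hi j -> t - delta <= f j) ->
  exists t', [/\ `|t' - t| <= delta, forall i, lo i -> f i <= t' &
    forall j, hi j -> t' <= f j].
Proof.
move=> d0 lohi lot hit; exists (\big[Num.max/t - delta]_(i | lo i) f i); split.
- rewrite ler_distl bigmax_ge_id /=.
  by apply: bigmax_le => //; rewrite lerD2l ge0_cp.
- by move=> i li; exact: le_bigmax_cond.
- by move=> j hj; apply: bigmax_le => [|i li]; [exact: hit|exact: lohi].
Qed.

Lemma le_succ_sum_norm (R : realFieldType) (I : finType) (f : I -> R) (i : I) :
  f i <= 1 + \sum_j `|f j|.
Proof.
rewrite (bigD1 i) //= (le_trans (ler_norm _)) // addrCA lerDl.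
by rewrite addr_ge0 // sumr_ge0.
Qed.

Lemma succ_sum_norm_gt0 (R : realFieldType) (I : finType) (f : I -> R) :
  0 < 1 + \sum_j `|f j|.
Proof. by rewrite ltr_wpDr // sumr_ge0. Qed.

Lemma ler_sum_mul_dist (R : realFieldType) (N : nat) (a x y : 'I_N -> R)
    (d : R) :
  (forall j, `|y j - x j| <= d) ->
  `|\sum_j a j * y j - \sum_j a j * x j| <= (\sum_j `|a j|) * d.
Proof.
move=> xy; rewrite -sumrB mulr_suml (le_trans (ler_norm_sum _ _ _)) //.
by apply: ler_sum => j _; rewrite -mulrBr normrM ler_wpM2l.
Qed.

(** A Hoffman bound that covers infeasible systems: if the system has no
    solution, the residuals are bounded below and [eps] is taken below that
    bound.  The proof eliminates one variable at a time.  The eliminated system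
    is indexed by pairs of rows: a row where the variable has a positive
    coefficient and one where it is negative are combined so as to cancel it,
    with nonnegative weights, so residuals grow by a bounded factor only.
    Moving the other variables to a solution of the eliminated system leaves for
    the last one a nonempty interval whose ends have shifted by O(rho). *)
Lemma inequality_system_error_bound (R : realFieldType) (N : nat) (I : finType)
    (a : I -> 'I_N -> R) (b : I -> R) :
  exists kappa eps : R, [/\ 0 <= kappa, 0 < eps &
    forall (x : 'I_N -> R) rho, 0 <= rho <= eps ->
      (forall i, \sum_j a i j * x j <= b i + rho) ->
      exists2 y : 'I_N -> R, (forall i, \sum_j a i j * y j <= b i) &
        forall j, `|y j - x j| <= kappa * rho].
Proof.
elim: N => [|N IH] in I a b *.
  case: (boolP [forall i, 0 <= b i]) => [/forallP b0|].
    exists 0, 1; split => // x rho _ _; exists x => [i|[]//].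
    by rewrite big_ord0.
  rewrite negb_forall => /existsP[i]; rewrite -ltNge => bi.
  exists 0, (- b i / 2); split => //; first lra.
  move=> x rho rb /(_ i); rewrite big_ord0; lra.
pose al i := a i ord0.
pose sg i (x : 'I_N -> R) := \sum_j a i (lift ord0 j) * x j.
(* The pairs without the required signs give either their first row, when the
   variable does not occur in it, or the trivial row 0 <= 0. *)
pose mu (p : I * I) := if (0 < al p.1) && (al p.2 < 0) then - al p.2
  else (al p.1 == 0)%:R.
pose nu (p : I * I) := if (0 < al p.1) && (al p.2 < 0) then al p.1 else 0.
have mu0 p : 0 <= mu p.
  by rewrite /mu; case: ifPn => [/andP[_ ?]|_]; [lra|exact: ler0n].
have nu0 p : 0 <= nu p by rewrite /nu; case: ifPn => [/andP[]|_]; [lra|].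
have munu p : mu p * al p.1 + nu p * al p.2 = 0.
  rewrite /mu /nu; case: ifPn => _; first ring.
  by case: eqP => [->|_]; rewrite ?mulr0 !mul0r addr0.
have [kap [eps [kap0 eps0 ihP]]] := IH (I * I)%type
  (fun p j => mu p * a p.1 (lift ord0 j) + nu p * a p.2 (lift ord0 j))
  (fun p => mu p * b p.1 + nu p * b p.2).
have combE p (x : 'I_N -> R) :
    \sum_j (mu p * a p.1 (lift ord0 j) + nu p * a p.2 (lift ord0 j)) * x j =
    mu p * sg p.1 x + nu p * sg p.2 x.
  rewrite /sg !mulr_sumr -big_split; apply: eq_bigr => j _ /=; ring.
pose K := 1 + \sum_p `|mu p + nu p|.
have K0 : 0 < K := succ_sum_norm_gt0 _.
(* How far, per unit of residual, the bound that row i puts on the eliminated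
   variable can move. *)
pose wid i := (1 + (\sum_j `|a i (lift ord0 j)|) * (kap * K)) / `|al i|.
pose D := 1 + \sum_i `|wid i|.
have D0 : 0 < D := succ_sum_norm_gt0 _.
exists (kap * K + D), (eps / K); split => [||x rho /andP[rho0 rhoe] xP].
- by rewrite addr_ge0 ?mulr_ge0 // ltW.
- exact: divr_gt0.
pose xt := x ord0; pose xl j := x (lift ord0 j).
have xE i : al i * xt + sg i xl <= b i + rho.
  by have := xP i; rewrite big_ord_recl.
have [|p|y yP yx] := ihP xl (K * rho).
- by rewrite mulr_ge0 ?(ltW K0) //= mulrC -ler_pdivlMr.
- rewrite combE.
  have h1 := ler_wpM2l (mu0 p) (xE p.1).
  have h2 := ler_wpM2l (nu0 p) (xE p.2).
  have h3 : (mu p + nu p) * rho <= K * rho.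
    by apply: ler_wpM2r => //; exact: (le_succ_sum_norm (fun p => mu p + nu p)).
  have h4 : (mu p * al p.1 + nu p * al p.2) * xt = 0 by rewrite munu mul0r.
  move: h1 h2 h3 h4; lra.
have {}yx j : `|y j - xl j| <= kap * K * rho by rewrite -mulrA.
have yE p : mu p * sg p.1 y + nu p * sg p.2 y <= mu p * b p.1 + nu p * b p.2.
  by rewrite -combE.
have sgy i : sg i y <= b i + rho - al i * xt +
    (\sum_j `|a i (lift ord0 j)|) * (kap * K * rho).
  have := ler_sum_mul_dist (fun j => a i (lift ord0 j)) yx.
  rewrite ler_norml -/(sg i y) -/(sg i xl) => /andP[_ h].
  by have := xE i; lra.
have widE i : al i != 0 -> b i - sg i y >= al i * xt - `|al i| * (D * rho).
  move=> ai.
  have : wid i * rho <= D * rho by apply: ler_wpM2r => //; exact: le_succ_sum_norm.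
  have ai0 : 0 < `|al i| by rewrite normr_gt0.
  rewrite -(ler_pM2l ai0) (mulrA _ (wid i)) (mulrC _ (wid i)) /wid.
  by rewrite divfK ?normr_eq0 //; have := sgy i; lra.
have [||i|j|t [tx tlo thi]] := @interval_point R I
  (fun i => al i < 0) (fun i => 0 < al i)
  (fun i => (b i - sg i y) / al i) xt (D * rho).
- by rewrite mulr_ge0 // ltW.
- move=> q p qlt pgt; have := yE (p, q).
  rewrite /mu /nu /= pgt qlt /= => h.
  rewrite ler_pdivlMr // mulrAC ler_ndivrMr //; lra.
- move=> ilt; rewrite ler_ndivrMr //.
  by have := widE i (ltr0_neq0 ilt); rewrite ltr0_norm //; lra.
- move=> jgt; rewrite ler_pdivlMr //.
  by have := widE j (lt0r_neq0 jgt); rewrite gtr0_norm //; lra.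
exists (fun j => if unlift ord0 j is Some j' then y j' else t).
  move=> i; rewrite big_ord_recl unlift_none.
  under eq_bigr do rewrite liftK.
  rewrite -/(al i) -/(sg i y).
  case: (ltrgt0P (al i)) => ai.
  - by have := thi i ai; rewrite ler_pdivlMr //; lra.
  - by have := tlo i ai; rewrite ler_ndivrMr //; lra.
  - by have := yE (i, i); rewrite /mu /nu /= ai ltxx eqxx /=; lra.
move=> j; case: unliftP => [j' ->|->].
  by apply: (le_trans (yx j')); rewrite (mulrDl (kap * K)) lerDl mulr_ge0 // ltW.
by apply: (le_trans tx); rewrite (mulrDl (kap * K)) lerDr !mulr_ge0 // ltW.
Qed.

(** * Error bound for piecewise polyhedral sets *)

(** The quantifiers also allow that [W *m z = c] has no solution in [Z]; then
    the bound says that the residual stays above [eps] on [Z].  This makes the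
    property stable under finite unions, some pieces of which may contain no
    solution, and lets it prove that linear images are closed. *)
Definition error_bound (R : realType) (N p : nat) (Z : set 'cV[R]_N)
    (W : 'M[R]_(p, N)) (c : 'cV[R]_p) : Prop :=
  exists kappa eps : R, [/\ 0 <= kappa, 0 < eps &
    forall z rho, Z z -> 0 <= rho <= eps ->
      (forall i, `|(W *m z - c) i 0| <= rho) ->
      exists z', [/\ Z z', W *m z' = c &
        forall j, `|z' j 0 - z j 0| <= kappa * rho]].


(** The equation is a pair of opposite inequalities added to those of [Z]. *)
Lemma polyhedral_error_bound (R : realType) (N p : nat) (Z : set 'cV[R]_N)
    (W : 'M[R]_(p, N)) (c : 'cV[R]_p) :
  polyhedral Z -> error_bound Z W c.
Proof.
move=> [m [M [b ->]]].
pose a (i : 'I_m + ('I_p + 'I_p)) (j : 'I_N) : R := match i with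
  | inl i => M i j | inr (inl i) => W i j | inr (inr i) => - W i j end.
pose d (i : 'I_m + ('I_p + 'I_p)) : R := match i with
  | inl i => b i 0 | inr (inl i) => c i 0 | inr (inr i) => - c i 0 end.
have [kap [eps [kap0 eps0 hP]]] := @inequality_system_error_bound R N _ a d.
exists kap, eps; split => // z rho Mz /[dup] /andP[rho0 _] rhoe Wz.
have [|y yd yz] := hP (fun j => z j 0) rho rhoe.
- move=> [i|[i|i]] /=.
  + by have := Mz i; rewrite mxE => /le_trans; apply; rewrite lerDl.
  + by have := Wz i; rewrite !mxE ler_norml; lra.
  + under eq_bigr do rewrite mulNr.
    by rewrite sumrN; have := Wz i; rewrite !mxE ler_norml; lra.
exists (\col_j y j); split=> [i||j]; last by rewrite mxE.
- rewrite mxE; under eq_bigr do rewrite mxE; exact: (yd (inl i)).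
- apply/colP => i; rewrite mxE; under eq_bigr do rewrite mxE.
  apply/eqP; rewrite eq_le (yd (inr (inl i))) /=.
  have := yd (inr (inr i)); rewrite /=.
  by under eq_bigr do rewrite mulNr; rewrite sumrN lerN2.
Qed.

Lemma error_bound_bigcup (R : realType) (N p : nat) (I : finType)
    (Z : I -> set 'cV[R]_N) (W : 'M[R]_(p, N)) (c : 'cV[R]_p) :
  (forall i, error_bound (Z i) W c) -> error_bound (\bigcup_i Z i) W c.
Proof.
move=> /choice[kap /choice[eps ZP]].
exists (1 + \sum_i `|kap i|), (\big[Num.min/1]_i eps i); split.
- by rewrite ltW // succ_sum_norm_gt0.
- by apply: lt_bigmin => // i _; have [] := ZP i.
move=> z rho [i _ Ziz] /andP[rho0 rhoe]; have [kap0 eps0 iP] := ZP i.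
move=> /(iP _ _ Ziz)[|z' [Zz' Wz' z'z]].
  by rewrite rho0 (le_trans rhoe) // bigmin_le.
exists z'; split => // [|j]; first by exists i.
apply: (le_trans (z'z j)); apply: ler_wpM2r => //; exact: le_succ_sum_norm.
Qed.

Lemma polyhedral_prod (R : realType) (N1 N2 : nat) (P : set 'cV[R]_N1)
    (Q : set 'cV[R]_N2) :
  polyhedral P -> polyhedral Q ->
  polyhedral [set z : 'cV[R]_(N1 + N2) | P (usubmx z) /\ Q (dsubmx z)].
Proof.
move=> [m1 [M1 [b1 ->]]] [m2 [M2 [b2 ->]]].
exists (m1 + m2)%N, (block_mx M1 0 0 M2), (col_mx b1 b2).
apply/seteqP; split=> z /=.
- rewrite -{3}[z]vsubmxK mul_block_col !mul0mx addr0 add0r.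
  by move=> [h1 h2] i; case: (split_ordP i) => j ->; rewrite ?col_mxEu ?col_mxEd.
- rewrite -{1}[z]vsubmxK mul_block_col !mul0mx addr0 add0r.
  move=> h; split => i.
  + by have := h (lshift _ i); rewrite !col_mxEu.
  + by have := h (rshift _ i); rewrite !col_mxEd.
Qed.

Lemma piecewise_polyhedral_error_bound (R : realType) (p q p' q' m : nat)
    (A : 'cV[R]_p -> set 'cV[R]_q) (B : 'cV[R]_p' -> set 'cV[R]_q')
    (W : 'M[R]_(m, (p + q) + (p' + q'))) (c : 'cV[R]_m) :
  piecewise_polyhedral A -> piecewise_polyhedral B ->
  error_bound [set z | gph A (usubmx z) /\ gph B (dsubmx z)] W c.
Proof.
move=> [r [P [polyP ->]]] [r' [Q [polyQ ->]]].
rewrite (_ : [set z | _] = \bigcup_(ij : 'I_r * 'I_r')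
  [set z | P ij.1 (usubmx z) /\ Q ij.2 (dsubmx z)]).
  apply: error_bound_bigcup => ij; apply: polyhedral_error_bound.
  exact: polyhedral_prod.
apply/seteqP; split=> [z [[i _ Pi] [j _ Qj]]|z [[i j] _ [Pi Qj]]].
- by exists (i, j).
- by split; [exists i|exists j].
Qed.

(** * Euclidean estimates and linear convergence *)

Lemma dotE (R : realType) (n : nat) (x y : 'cV[R]_n) :
  dot x y = \sum_i x i 0 * y i 0.
Proof. by rewrite /dot mxE; apply: eq_bigr => i _; rewrite mxE. Qed.

Lemma dotC (R : realType) (n : nat) (x y : 'cV[R]_n) : dot x y = dot y x.
Proof. by rewrite !dotE; apply: eq_bigr => i _; rewrite mulrC. Qed.

Lemma dotDr (R : realType) (n : nat) (x y z : 'cV[R]_n) :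
  dot x (y + z) = dot x y + dot x z.
Proof. by rewrite /dot mulmxDr mxE. Qed.

Lemma dotZr (R : realType) (n : nat) (a : R) (x y : 'cV[R]_n) :
  dot x (a *: y) = a * dot x y.
Proof. by rewrite /dot -scalemxAr mxE. Qed.

Lemma dotNr (R : realType) (n : nat) (x y : 'cV[R]_n) : dot x (- y) = - dot x y.
Proof. by rewrite -scaleN1r dotZr mulN1r. Qed.

Lemma dotDl (R : realType) (n : nat) (x y z : 'cV[R]_n) :
  dot (y + z) x = dot y x + dot z x.
Proof. by rewrite dotC dotDr !(dotC x). Qed.

Lemma dotZl (R : realType) (n : nat) (a : R) (x y : 'cV[R]_n) :
  dot (a *: y) x = a * dot y x.
Proof. by rewrite dotC dotZr dotC. Qed.

Lemma dotNl (R : realType) (n : nat) (x y : 'cV[R]_n) : dot (- y) x = - dot y x.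
Proof. by rewrite dotC dotNr dotC. Qed.

Lemma dot_ge0 (R : realType) (n : nat) (x : 'cV[R]_n) : 0 <= dot x x.
Proof. by rewrite dotE sumr_ge0 // => i _; rewrite -expr2 sqr_ge0. Qed.

Lemma dot_col_mx (R : realType) (n m : nat) (x y : 'cV[R]_n) (x' y' : 'cV[R]_m) :
  dot (col_mx x x') (col_mx y y') = dot x y + dot x' y'.
Proof. by rewrite /dot tr_col_mx mul_row_col mxE. Qed.

Lemma coord_le_sqrt_dot (R : realType) (n : nat) (x : 'cV[R]_n) (i : 'I_n) :
  `|x i 0| <= Num.sqrt (dot x x).
Proof.
rewrite -sqrtr_sqr ler_wsqrtr // dotE (bigD1 i) //= -expr2 lerDl.
by rewrite sumr_ge0 // => j _; rewrite -expr2 sqr_ge0.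
Qed.

Lemma dot_le_of_coord (R : realType) (n : nat) (x : 'cV[R]_n) (d : R) :
  (forall i, `|x i 0| <= d) -> dot x x <= n%:R * d ^+ 2.
Proof.
move=> xd; rewrite dotE (@le_trans _ _ (\sum_(i < n) d ^+ 2)) //.
  apply: ler_sum => i _; rewrite -expr2 -real_normK ?num_real //.
  by rewrite lerXn2r ?nnegrE // (le_trans _ (xd i)).
by rewrite sumr_const card_ord mulr_natl.
Qed.

(** The parallelogram identity replaces the triangle inequality, which keeps
    all estimates on squared norms. *)
Lemma sqdist_le_via (R : realType) (n : nat) (x y p : 'cV[R]_n) :
  dot (x - y) (x - y) <= 2 * dot (x - p) (x - p) + 2 * dot (y - p) (y - p).
Proof.
have := dot_ge0 ((x - p) + (y - p)).
rewrite !(dotDl, dotDr, dotNl, dotNr) !(dotC p) (dotC y x); lra.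
Qed.

Lemma limn_einf_gt0 (R : realType) (f : nat -> R) :
  (0 < limn_einf (fun k => (f k)%:E))%E ->
  exists (c : R) (k0 : nat), 0 < c /\ forall k, (k0 <= k)%N -> c <= f k.
Proof.
rewrite limn_einf_lim (cvg_lim _ (@cvg_einfs_sup R _)) //.
move=> /ereal_sup_gt[_ [k0 _ <-]].
have cf k : (k0 <= k)%N ->
    (einfs (fun k => (f k)%:E) k0 <= (f k)%:E)%E.
  by move=> k0k; apply: ereal_inf_lbound; exists k.
move: cf; case: (einfs _ _) => [c cf c0|/(_ k0 (leqnn _))|//]; last by rewrite leye_eq.
exists c, k0; split => [|k k0k]; first by rewrite -lte_fin.
by rewrite -lee_fin; exact: cf.
Qed.

(** The intervals of radius [w k] around [x k] meet pairwise, so they have a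
    common point, the supremum of their lower ends. *)
Lemma nested_interval_limit (R : realType) (x w : nat -> R) (k0 : nat) :
  (forall k m, (k0 <= k)%N -> (k <= m)%N -> `|x m - x k| <= w k) ->
  exists l, forall k, (k0 <= k)%N -> `|x k - l| <= w k.
Proof.
move=> xw.
pose E := [set x k - w k | k in [set k | (k0 <= k)%N]].
have Eub k : (k0 <= k)%N -> ubound E (x k + w k).
  move=> k0k _ [j /= k0j <-].
  have := xw k (maxn j k) k0k (leq_maxr _ _).
  have := xw j (maxn j k) k0j (leq_maxl _ _).
  rewrite !ler_norml; lra.
exists (sup E) => k k0k.
have h1 : sup E <= x k + w k.
  by apply: ge_sup (Eub k k0k); exists (x k - w k); exists k.
have h2 : x k - w k <= sup E.
  by apply: ub_le_sup; [exists (x k + w k); exact: Eub|exists k].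
by rewrite ler_norml; lra.
Qed.

(** The majorant is the norm itself before [k0]; a square root appears because
    the estimates to which this is applied bound squared norms. *)
Lemma R_linear_of_geometric (R : realType) (E : zmodType) (N : E -> R)
    (z : nat -> E) (zs : E) (C q : R) (k0 : nat) :
  0 < q < 1 -> 0 <= C ->
  (forall k, (k0 <= k)%N -> N (z k - zs) <= Num.sqrt (C * q ^+ k)) ->
  R_linear N z zs.
Proof.
move=> /andP[q0 q1] C0 zC.
exists (fun k => if (k < k0)%N then `|N (z k - zs)| else Num.sqrt (C * q ^+ k)).
split=> [k|| k].
- by case: ifP => // _; exact: sqrtr_ge0.
- exists (Num.sqrt q), k0; split.
    rewrite sqrtr_gt0 q0 /= -[X in _ < X]sqrtr1 ltr_sqrt //.
  move=> k k0k; rewrite !subr0 !ltnNge k0k leqW //= !ger0_norm ?sqrtr_ge0 //.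
  by rewrite exprS mulrCA sqrtrM // ltW.
- by case: ltnP => [_|/zC //]; exact: ler_norm.
Qed.

(** With [D k] the squared distance from [s k] to [S], the Fejer inequality
    gives [D k.+1 + c * r k <= D k].  Since [D] decreases and is bounded below,
    [r k] eventually falls below [eps], from where on [D k <= K * r k], so that
    [D] contracts by the factor [K / (K + c)]. *)
Lemma fejer_error_bound_geometric (R : realType) (n : nat) (S : set 'cV[R]_n)
    (s : nat -> 'cV[R]_n) (r : nat -> R) (c K eps : R) (k0 : nat) :
  S !=set0 -> 0 < c -> 0 < K -> 0 < eps -> (forall k, 0 <= r k) ->
  (forall k p, (k0 <= k)%N -> S p ->
    dot (s k.+1 - p) (s k.+1 - p) + c * r k <= dot (s k - p) (s k - p)) ->
  (forall k, r k <= eps ->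
    exists2 p, S p & dot (s k - p) (s k - p) <= K * r k) ->
  exists (C q : R) (k1 : nat), [/\ 0 <= C, 0 < q < 1, (k0 <= k1)%N &
    forall k, (k1 <= k)%N -> r k <= C * q ^+ k /\
      exists2 p, S p & dot (s k - p) (s k - p) <= C * q ^+ k].
Proof.
move=> S0 c0 K0 eps0 r0 fejer eb.
pose dists k := [set dot (s k - p) (s k - p) | p in S].
pose D k := inf (dists k).
have dists0 k : dists k !=set0 by case: S0 => p Sp; exists (dot (s k - p) (s k - p)), p.
have D_lb k : lbound (dists k) 0 by move=> _ [p _ <-]; exact: dot_ge0.
have D0 k : 0 <= D k by exact: lb_le_inf.
have Dle k p : S p -> D k <= dot (s k - p) (s k - p).
  by move=> Sp; apply: ge_inf; [exists 0|exists p].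
have Ddec k : (k0 <= k)%N -> D k.+1 + c * r k <= D k.
  move=> k0k; apply: lb_le_inf => // _ [p Sp <-].
  by apply: le_trans (fejer k p k0k Sp); rewrite lerD2r Dle.
pose Dr := [set D k | k in [set k | (k0 <= k)%N]].
(* Once [D k1] is within [c * eps] of the infimum of all later values, no
   single decrease [c * r k] can exceed [c * eps]. *)
have [k1 k0k1 r_eps] :
    exists2 k1, (k0 <= k1)%N & forall k, (k1 <= k)%N -> r k <= eps.
  have [||_ [k1 /= k0k1 <-] Dk1] := @inf_adherent R Dr (c * eps).
  - exact: mulr_gt0.
  - by split; [exists (D k0); exists k0 => /=|exists 0 => _ [k _ <-]].
  exists k1 => // k k1k.
  have k0k := leq_trans k0k1 k1k.
  have Dkk1 : D k <= D k1.
    rewrite -(subnK k1k); elim: (_ - _)%N => // j; rewrite addSn.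
    apply: le_trans; have jk0 : (k0 <= j + k1)%N by rewrite (leq_trans k0k1) ?leq_addl.
    have := Ddec _ jk0; have := mulr_ge0 (ltW c0) (r0 (j + k1)%N); lra.
  have Dinf : inf Dr <= D k.+1.
    apply: ge_inf; first by exists 0 => _ [j _ <-].
    by exists k.+1 => //=; exact: leqW.
  have := Ddec k k0k; rewrite -(ler_pM2l c0 (r k)); lra.
pose q := K / (K + c).
have Kc : 0 < K + c by exact: addr_gt0.
have q0 : 0 < q by exact: divr_gt0.
have q1 : q < 1 by rewrite ltr_pdivrMr // mul1r ltrDl.
have DK k : (k1 <= k)%N -> D k <= K * r k.
  by move=> k1k; have [p Sp] := eb k (r_eps k k1k); exact/le_trans/Dle.
have Dq k : (k1 <= k)%N -> D k.+1 <= q * D k.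
  move=> k1k; have h1 := Ddec k (leq_trans k0k1 k1k); have h2 := DK k k1k.
  rewrite /q mulrAC ler_pdivlMr //.
  have h3 := ler_wpM2l (ltW K0) h1; have h4 := ler_wpM2l (ltW c0) h2.
  have h5 := ler_wpM2l (ltW c0) h1.
  have := mulr_ge0 (ltW c0) (mulr_ge0 (ltW c0) (r0 k)).
  lra.
pose C0 := D k1 / q ^+ k1.
have C00 : 0 <= C0 by rewrite divr_ge0 // exprn_ge0 // ltW.
have Dgeo k : (k1 <= k)%N -> D k <= C0 * q ^+ k.
  move=> k1k; rewrite -(subnK k1k); elim: (_ - _)%N => [|j IH].
    by rewrite add0n divfK // expf_neq0 // gt_eqF.
  rewrite addSn exprS mulrCA (le_trans (Dq _ (leq_addl _ _))) //.
  by rewrite ler_pM2l.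
have rgeo k : (k1 <= k)%N -> r k <= C0 * q ^+ k / c.
  move=> k1k; rewrite ler_pdivlMr // mulrC (le_trans _ (Dgeo k k1k)) //.
  by have := Ddec k (leq_trans k0k1 k1k); have := D0 k.+1; lra.
exists ((1 + K) * (C0 / c)), q, k1; split; rewrite ?q0 //.
  by apply: mulr_ge0; [rewrite addr_ge0 // ltW|rewrite divr_ge0 // ltW].
move=> k k1k; have := rgeo k k1k; rewrite mulrAC => rk.
have g0 : 0 <= C0 / c * q ^+ k := le_trans (r0 k) rk.
split.
  by rewrite (le_trans rk) // -(mulrA (1 + K)) mulrDl mul1r lerDl mulr_ge0 // ltW.
have [p Sp spK] := eb k (r_eps k k1k); exists p => //.
rewrite (le_trans spK) // -(mulrA (1 + K)).
have := ler_wpM2l (ltW K0) rk; lra.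
Qed.

Lemma geometric_eventually_le (R : realType) (C q eps : R) (k0 : nat) :
  0 < q < 1 -> 0 < eps ->
  exists2 k, (k0 <= k)%N & C * q ^+ k <= eps.
Proof.
move=> /andP[q0 q1] eps0.
have q1' : `|q| < 1 by rewrite gtr0_norm.
have /cvgrPdist_le/(_ _ eps0)[k _ kP] := cvg_geometric C q1'.
exists (maxn k0 k); first exact: leq_maxl.
have := kP _ (leq_maxr k0 k); rewrite sub0r normrN /geometric /=.
exact: le_trans (ler_norm _).
Qed.

Lemma enorm_ge0 (R : realType) (n : nat) (x : 'cV[R]_n) : 0 <= enorm x.
Proof. exact: sqrtr_ge0. Qed.

(** Any near point [p] of [S] at time [k] stays near for all later times by the
    Fejer property, so two later iterates differ by at most twice the distance
    at time [k]: the sequence is Cauchy with a geometric rate. *)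
Lemma geometric_fejer_limit (R : realType) (n : nat) (S : set 'cV[R]_n)
    (s : nat -> 'cV[R]_n) (C q : R) (k1 : nat) :
  0 <= C -> 0 < q < 1 ->
  (forall k p, (k1 <= k)%N -> S p ->
    dot (s k.+1 - p) (s k.+1 - p) <= dot (s k - p) (s k - p)) ->
  (forall k, (k1 <= k)%N ->
    exists2 p, S p & dot (s k - p) (s k - p) <= C * q ^+ k) ->
  exists sstar : 'cV[R]_n, R_linear (@enorm R n) s sstar /\
    forall eps, 0 < eps ->
      exists2 p, S p & forall i, `|(p - sstar) i 0| <= eps.
Proof.
move=> C0 /[dup] q01 /andP[q0 q1] fejer near.
pose w k := Num.sqrt (C * q ^+ k).
have Cq0 k : 0 <= C * q ^+ k by rewrite mulr_ge0 // exprn_ge0 // ltW.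
have w0 k : 0 <= w k by exact: sqrtr_ge0.
have w2 k : w k ^+ 2 = C * q ^+ k by rewrite sqr_sqrtr.
have mono k m p : (k1 <= k)%N -> (k <= m)%N -> S p ->
    dot (s m - p) (s m - p) <= dot (s k - p) (s k - p).
  move=> k1k km Sp; rewrite -(subnK km); elim: (_ - _)%N => // j.
  apply: le_trans; rewrite addSn; apply: fejer => //.
  by rewrite (leq_trans k1k) // leq_addl.
have cauchy k m i : (k1 <= k)%N -> (k <= m)%N ->
    `|s m i 0 - s k i 0| <= 2 * w k.
  move=> k1k km; have [p Sp spk] := near k k1k.
  have := coord_le_sqrt_dot (s m - s k) i; rewrite !mxE => /le_trans; apply.
  have w20 : 0 <= 2 * w k by rewrite mulr_ge0.
  rewrite -(ger0_norm w20) -sqrtr_sqr ler_wsqrtr //.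
  rewrite (le_trans (sqdist_le_via _ _ p)) // exprMn w2.
  by have := mono k m p k1k km Sp; lra.
have /choice[l lP] : forall i, exists li, forall k, (k1 <= k)%N ->
    `|s k i 0 - li| <= 2 * w k.
  by move=> i; apply: nested_interval_limit => k m k1k km; exact: cauchy.
exists (\col_i l i); split.
  apply: (@R_linear_of_geometric _ _ _ _ _ (n%:R * (4 * C)) q k1) => //.
    by rewrite !mulr_ge0.
  move=> k k1k; rewrite /enorm ler_wsqrtr //.
  have -> : n%:R * (4 * C) * q ^+ k = n%:R * (2 * w k) ^+ 2.
    by rewrite exprMn w2; ring.
  by apply: dot_le_of_coord => i; rewrite !mxE; exact: lP.
move=> eps eps0.
have e3 : 0 <= eps / 3 by rewrite divr_ge0 // ltW.
have [|k k1k kP] := @geometric_eventually_le _ C q ((eps / 3) ^+ 2) k1 q01.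
  by rewrite exprn_gt0 // divr_gt0.
have wk : w k <= eps / 3 by rewrite -(ger0_norm e3) -sqrtr_sqr ler_wsqrtr.
have [p Sp spk] := near k k1k; exists p => // i.
have h1 : `|(s k - p) i 0| <= w k.
  by rewrite (le_trans (coord_le_sqrt_dot _ _)) // ler_wsqrtr.
have := lP i k k1k; move: h1; rewrite !mxE !ler_norml; lra.
Qed.

(** * Weak Minty solutions and Douglas-Rachford steps *)

Lemma stepsize_lb_ge0 (R : realType) (bP bD : R) : 0 <= stepsize_lb bP bD.
Proof.
rewrite /stepsize_lb; case: ifP => // _.
by rewrite divr_ge0 ?mulr_ge0 ?addr_ge0 ?sqrtr_ge0 // /pospart le_max lexx.
Qed.

(** The weak Minty inequality is applied to the value [(a + b, v - u)] of the
    primal-dual operator at [(u, b)]; multiplied by [gamma], its left side is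
    <u - v, s - p - (u - v)> with [s = u + gamma a] and [p = x - gamma y], and
    the term - |u - v|^2 contributes the [1] in the coefficient. *)
Lemma weak_minty_residual (R : realType) (n : nat)
    (A B : 'cV[R]_n -> set 'cV[R]_n) (bP bD gamma : R)
    (u a v b x y : 'cV[R]_n) :
  oblique_weak_minty (blkdiagV n bP bD) (T_PD A B) (zer (T_PD A B)) ->
  0 < gamma -> A u a -> B v b -> u - v = gamma *: (a + b) ->
  zer (T_PD A B) (col_mx x y) ->
  (1 + 1 / gamma * bP + gamma * bD) * dot (u - v) (u - v) <=
  dot (u - v) (u + gamma *: a - (x - gamma *: y)).
Proof.
move=> [_ _ minty] g0 Aua Bvb uv zxy.
have : gph (T_PD A B) (col_mx (col_mx u b) (col_mx (a + b) (v - u))).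
  rewrite /gph /T_PD /= !col_mxKu !col_mxKd.
  by exists a => //; exists v.
move=> /(minty _ _ _ zxy).
rewrite /blkdiagV mul_block_col !mul0mx addr0 add0r !mul_scalar_mx.
rewrite opp_col_mx add_col_mx !dot_col_mx.
have ab : a + b = gamma^-1 *: (u - v) by rewrite uv scalerA mulVf ?gt_eqF ?scale1r.
have -> : u + gamma *: a - (x - gamma *: y) =
    (u - x) + (u - v) - gamma *: (b - y).
  by rewrite uv !scalerDr scalerN; apply/colP => i; rewrite !mxE; ring.
rewrite ab -(opprB u v) !(dotZl, dotZr, dotNl, dotNr).
move: (u - v) => r h.
rewrite !(dotDr _ (u - x + r), dotDr _ (u - x) r) dotNr dotZr.
rewrite -(ler_pM2l g0) in h.
have gK : gamma * gamma^-1 = 1 by rewrite divff // gt_eqF.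
have h1 : gamma * (gamma^-1 * dot r (u - x)) = dot r (u - x) by rewrite mulrA gK mul1r.
have h2 : gamma * (bP * (gamma^-1 * (gamma^-1 * dot r r))) = gamma^-1 * bP * dot r r.
  by field; rewrite gt_eqF.
rewrite div1r; move: h h1 h2; lra.
Qed.

Definition DRS_limits (R : realType) (n : nat)
    (A B : 'cV[R]_n -> set 'cV[R]_n) (gamma : R) : set 'cV[R]_n :=
  [set s | exists x y, zer (T_PD A B) (col_mx x y) /\ s = x - gamma *: y].

(** The two matrices act on [(u, a, v, b)] by [(u - v, a + b)] and
    [u + gamma a]. *)
Definition residual_mx (R : realType) (n : nat) :
    'M[R]_(n + n, (n + n) + (n + n)) :=
  row_mx 1%:M (block_mx (- 1%:M) 0 0 1%:M).

Definition governing_mx (R : realType) (n : nat) (gamma : R) :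
    'M[R]_(n, (n + n) + (n + n)) :=
  row_mx (row_mx 1%:M gamma%:M) 0.

Lemma residual_mxE (R : realType) (n : nat) (u a v b : 'cV[R]_n) :
  residual_mx R n *m col_mx (col_mx u a) (col_mx v b) = col_mx (u - v) (a + b).
Proof.
rewrite mul_row_col mul1mx mul_block_col !mul0mx mulNmx !mul1mx addr0 add0r.
by rewrite add_col_mx.
Qed.

Lemma governing_mxE (R : realType) (n : nat) (gamma : R)
    (u a v b : 'cV[R]_n) :
  governing_mx n gamma *m col_mx (col_mx u a) (col_mx v b) = u + gamma *: a.
Proof. by rewrite mul_row_col mul0mx addr0 mul_row_col mul1mx mul_scalar_mx. Qed.

(** A zero of the primal-dual operator is a tuple on which [residual_mx]
    vanishes: [u = v = x] and [b = - a = y]. *)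
Lemma DRS_limitsE (R : realType) (n : nat) (A B : 'cV[R]_n -> set 'cV[R]_n)
    (gamma : R) :
  DRS_limits A B gamma = [set governing_mx n gamma *m z | z in
    [set z | (gph A (usubmx z) /\ gph B (dsubmx z)) /\
             residual_mx R n *m z = 0]].
Proof.
apply/seteqP; split => [_ [x [y [[a Aa [b Bb]] /= + ->]]]|_ [z [[Az Bz] zr] <-]].
  move: Aa Bb; rewrite /op_inv /= !col_mxKu !col_mxKd => Aa Bb.
  rewrite -col_mx0 => /eq_col_mx[/eqP + /subr0_eq bx].
  rewrite addr_eq0 => /eqP ay.
  exists (col_mx (col_mx x a) (col_mx b y)) => /=.
    split; first by rewrite /gph /= !(col_mxKu, col_mxKd).
    by rewrite residual_mxE bx ay subrr addNr col_mx0.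
  by rewrite governing_mxE ay scalerN.
rewrite -[z]vsubmxK -[usubmx z]vsubmxK -[dsubmx z]vsubmxK in zr *.
move: Az Bz; rewrite /gph /=.
move: (usubmx (usubmx z)) (dsubmx (usubmx z)) (usubmx (dsubmx z))
  (dsubmx (dsubmx z)) zr => u a v b + Aua Bvb.
rewrite residual_mxE governing_mxE -col_mx0 => /eq_col_mx[/subr0_eq uv /eqP].
rewrite addr_eq0 => /eqP ab.
exists u, b; split; last by rewrite ab scalerN.
exists a; first by rewrite col_mxKu.
exists u; first by rewrite /op_inv /= col_mxKd uv.
by rewrite col_mxKu col_mxKd ab addNr subrr col_mx0.
Qed.

(** Since [a + b] is the multiple [gamma^-1] of [u - v], smallness of [u - v]
    alone makes the whole residual [(u - v, a + b)] small. *)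
Lemma DRS_limits_error_bound (R : realType) (n : nat)
    (A B : 'cV[R]_n -> set 'cV[R]_n) (gamma : R) :
  piecewise_polyhedral A -> piecewise_polyhedral B -> 0 < gamma ->
  exists K eps : R, [/\ 0 < K, 0 < eps & forall u a v b,
    A u a -> B v b -> u - v = gamma *: (a + b) -> dot (u - v) (u - v) <= eps ->
    exists2 p, DRS_limits A B gamma p &
      dot (u + gamma *: a - p) (u + gamma *: a - p) <= K * dot (u - v) (u - v)].
Proof.
move=> pA pB g0.
have [kap [eps [kap0 eps0 ebP]]] :=
  @piecewise_polyhedral_error_bound R _ _ _ _ _ A B (residual_mx R n) 0 pA pB.
have gV0 : 0 < gamma^-1 by rewrite invr_gt0.
pose L := 1 + gamma^-1.
have L0 : 0 < L by rewrite addr_gt0.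
exists (1 + n%:R * ((1 + gamma) * (kap * L)) ^+ 2), ((eps / L) ^+ 2).
split=> [||u a v b Aua Bvb uv rle].
- by rewrite ltr_wpDr // mulr_ge0 // sqr_ge0.
- by rewrite exprn_gt0 // divr_gt0.
set r := dot (u - v) (u - v) in rle *.
pose t := Num.sqrt r.
have r0 : 0 <= r := dot_ge0 _.
have t0 : 0 <= t := sqrtr_ge0 _.
have tL : t * L <= eps.
  have eL : 0 <= eps / L by rewrite divr_ge0 // ltW.
  by rewrite -ler_pdivlMr // -(ger0_norm eL) -sqrtr_sqr ler_wsqrtr.
pose z := col_mx (col_mx u a) (col_mx v b).
have [|||z' [[Az' Bz'] rz' z'z]] := ebP z (t * L).
- by rewrite /gph /z /= !(col_mxKu, col_mxKd).
- by rewrite tL mulr_ge0 // ltW.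
- move=> i; rewrite subr0 residual_mxE.
  have -> : a + b = gamma^-1 *: (u - v) by rewrite uv scalerA mulVf ?gt_eqF ?scale1r.
  case: (split_ordP i) => j ->; rewrite ?col_mxEu ?col_mxEd.
    by rewrite (le_trans (coord_le_sqrt_dot _ j)) // mulrDr mulr1 lerDl mulr_ge0 // ltW.
  rewrite mxE normrM gtr0_norm // mulrDr mulr1 -[leLHS]add0r lerD //.
  by rewrite mulrC ler_wpM2r ?(ltW gV0) // coord_le_sqrt_dot.
exists (governing_mx n gamma *m z').
  by rewrite DRS_limitsE; exists z'.
have -> : u + gamma *: a = governing_mx n gamma *m z by rewrite governing_mxE.
rewrite -mulmxBr.
have zz' j : `|(z - z') j 0| <= kap * (t * L).
  by have := z'z j; rewrite distrC !mxE.
apply: (@le_trans _ _ (n%:R * ((1 + gamma) * (kap * L)) ^+ 2 * r)); last first.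
  by rewrite ler_wpM2r // lerDr.
rewrite -[r]sqr_sqrtr // -/t -mulrA -exprMn.
apply: dot_le_of_coord => i.
move: (z - z') zz' => y.
rewrite -[y]vsubmxK -[usubmx y]vsubmxK -[dsubmx y]vsubmxK.
move: (usubmx (usubmx y)) (dsubmx (usubmx y)) (usubmx (dsubmx y))
  (dsubmx (dsubmx y)) => x1 x2 x3 x4 zz'.
rewrite governing_mxE !mxE (le_trans (ler_normD _ _)) // normrM (gtr0_norm g0).
have := zz' (lshift _ (lshift _ i)); rewrite !col_mxEu => h1.
have := zz' (lshift _ (rshift _ i)); rewrite col_mxEu col_mxEd.
by rewrite -(ler_pM2l g0); lra.
Qed.

(** If [c] were outside of the set, prescribing [u + gamma a = c] besides a
    zero residual would have no solution on the piecewise polyhedral set, and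
    the error bound would keep the set at a positive distance from [c]. *)
Lemma DRS_limits_closed (R : realType) (n : nat)
    (A B : 'cV[R]_n -> set 'cV[R]_n) (gamma : R) (c : 'cV[R]_n) :
  piecewise_polyhedral A -> piecewise_polyhedral B ->
  exists2 eps : R, 0 < eps & forall p, DRS_limits A B gamma p ->
    (forall i, `|(p - c) i 0| <= eps) -> DRS_limits A B gamma c.
Proof.
move=> pA pB.
have [kap [eps [_ eps0 ebP]]] := @piecewise_polyhedral_error_bound R _ _ _ _ _ A B
  (col_mx (residual_mx R n) (governing_mx n gamma)) (col_mx 0 c) pA pB.
exists eps => // p; rewrite DRS_limitsE => -[z [Zz rz] <-] pc.
have [||z' [Zz']] := ebP z eps Zz.
- by rewrite lexx ltW.
- move=> i; rewrite mul_col_mx rz opp_col_mx add_col_mx subr0.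
  case: (split_ordP i) => j ->; rewrite ?col_mxEu ?col_mxEd //.
  by rewrite mxE normr0 ltW.
- by rewrite mul_col_mx => /eq_col_mx[rz' gz'] _; exists z'.
Qed.

Lemma DRS_step (R : realType) (n : nat) (A B : 'cV[R]_n -> set 'cV[R]_n)
    (gamma : R) (lambda : nat -> R) (u v s : nat -> 'cV[R]_n) (k : nat) :
  is_DRS A B gamma lambda u v s ->
  exists a b, [/\ A (u k) a, B (v k) b, s k = u k + gamma *: a,
    u k - v k = gamma *: (a + b) & s k.+1 = s k - lambda k *: (u k - v k)].
Proof.
move=> /(_ k)[[_ [a Aa <-] us] [_ [b Bb <-] vs] sS].
exists a, b; split => //; last by rewrite sS -scalerN opprB.
move: vs; rewrite -us => /(congr1 (fun x => x - v k - gamma *: a)).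
move=> /colP h; apply/colP => i; have := h i; rewrite !mxE; lra.
Qed.

Theorem theorem3p6 (R : realType) (n : nat)
    (A B : 'cV[R]_n -> set 'cV[R]_n)
    (hA : piecewise_polyhedral A) (hB : piecewise_polyhedral B)
    (zer_nonempty : zer (T_PD A B) !=set0)
    (zer_closed : closed (zer (T_PD A B)))
    (zer_convex : convex_set (zer (T_PD A B)))
    (bP bD : R) (hbeta : negpart bD * negpart bP < 1 / 4)
    (hminty : oblique_weak_minty (blkdiagV n bP bD) (T_PD A B)
                (zer (T_PD A B)))
    (gamma : R)
    (hgamma : ((stepsize_lb bP bD)%:E < gamma%:E < stepsize_ub bP bD)%E)
    (domA : full_domain (resolvent (op_scale gamma A)))
    (domB : full_domain (resolvent (op_scale gamma B)))
    (contA : sv_continuous (resolvent (op_scale gamma A)))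
    (contB : sv_continuous (resolvent (op_scale gamma B)))
    (alpha : R) (halpha : alpha = 1 + 1 / gamma * bP + gamma * bD)
    (lambda : nat -> R)
    (hlambda : forall k, 0 < lambda k < 2 * alpha)
    (hliminf : (0 < limn_einf
                  (fun k => (lambda k * (2 * alpha - lambda k))%:E))%E)
    (u v s : nat -> 'cV[R]_n)
    (hDRS : is_DRS A B gamma lambda u v s) :
  (exists2 sstar : 'cV[R]_n,
     (exists xstar ystar : 'cV[R]_n,
        zer (T_PD A B) (col_mx xstar ystar) /\
        sstar = xstar - gamma *: ystar) &
     R_linear (@enorm R n) s sstar) /\
  R_linear (fun t : R => `|t|) (fun k => enorm (u k - v k)) 0.
Proof.
have g0 : 0 < gamma.
  case/andP: hgamma => + _; rewrite lte_fin; apply: le_lt_trans.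
  exact: stepsize_lb_ge0.
have [c [k0 [c0 lamc]]] := limn_einf_gt0 hliminf.
have [K [eps [K0 eps0 eb]]] := DRS_limits_error_bound hA hB g0.
pose r k := dot (u k - v k) (u k - v k).
have r0 k : 0 <= r k by exact: dot_ge0.
have S0 : DRS_limits A B gamma !=set0.
  case: zer_nonempty => z; rewrite -[z]vsubmxK => zz.
  by exists (usubmx z - gamma *: dsubmx z), (usubmx z), (dsubmx z).
(* Expand the square of the relaxed update and bound its cross term with
   [weak_minty_residual]. *)
have fejer k p : (k0 <= k)%N -> DRS_limits A B gamma p ->
    dot (s k.+1 - p) (s k.+1 - p) + c * r k <= dot (s k - p) (s k - p).
  move=> k0k [x [y [zxy ->]]].
  have [a [b [Aa Bb sk uv ->]]] := DRS_step k hDRS.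
  have := weak_minty_residual hminty g0 Aa Bb uv zxy.
  rewrite -sk -halpha addrAC.
  have /andP[l0 _] := hlambda k.
  have h2 := ler_wpM2r (r0 k) (lamc k k0k).
  rewrite /r in h2 *; move: (s k - _) (u k - v k) h2 => e d h2 minty.
  have h1 := ler_wpM2l (ltW l0) minty.
  rewrite !(dotDl, dotDr, dotNl, dotNr, dotZl, dotZr) (dotC e).
  lra.
have error k : r k <= eps -> exists2 p, DRS_limits A B gamma p &
    dot (s k - p) (s k - p) <= K * r k.
  by have [a [b [Aa Bb -> uv _]]] := DRS_step k hDRS; exact: (eb _ _ _ _ Aa Bb uv).
have [C [q [k1 [C0 q01 k01 geo]]]] :=
  fejer_error_bound_geometric S0 c0 K0 eps0 r0 fejer error.
split; last first.
  apply: (R_linear_of_geometric (k0 := k1) q01 C0) => k k1k.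
  by rewrite subr0 ger0_norm ?enorm_ge0 // ler_wsqrtr //; case: (geo k k1k).
have [|k /geo[]//|l [sl near]] := @geometric_fejer_limit R n
  (DRS_limits A B gamma) s C q k1 C0 q01.
  move=> k p k1k Sp; apply: le_trans (fejer k p (leq_trans k01 k1k) Sp).
  by rewrite lerDl mulr_ge0 // ltW.
have [eps' eps'0 closedS] := DRS_limits_closed gamma l hA hB.
have [p Sp pl] := near _ eps'0.
by exists l => //; exact: closedS pl.
Qed.
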